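(* The map $\sigma\mapsto(R(\sigma),S(\sigma))$ (Extended Patience Sorting) is a bijection from $\mathfrak{S}_n$ onto the set $\Sigma(n)$ of all ordered pairs $(R,S)$ of pile configurations on $[n]$ such that $\mathrm{sh}(R)=\mathrm{sh}(S)$ and the pair $(RPW(R),RPW(S'))$ avoids simultaneous occurrences of the pairs of patterns $(31\mathrm{-}2,13\mathrm{-}2)$, $(31\mathrm{-}2,32\mathrm{-}1)$ and $(32\mathrm{-}1,13\mathrm{-}2)$ at the same positions.
   Context: Extended Patience Sorting: given $\sigma=\sigma_1\cdots\sigma_n\in\mathfrak{S}_n$, process $\sigma_1,\dots,\sigma_n$ in order, maintaining left-to-right insertion piles $r_1,r_2,\dots$ and recording piles $s_1,s_2,\dots$. $\sigma_1$ starts pile $r_1$ and $s_1=\{1\}$. For $i\ge2$, if some pile has top card larger than $\sigma_i$, place $\sigma_i$ on top of the leftmost such pile $r_j$ and add $i$ to $s_j$; otherwise start a new pile $r_{k+1}=\{\sigma_i\}$ to the right and set $s_{k+1}=\{i\}$. Thus $R(\sigma)=(r_1,\dots,r_m)$ and $S(\sigma)=(s_1,\dots,s_m)$, where $s_j$ is the set of positions of the cards in $r_j$. A pile configuration on $[n]$ is any sequence of sets $R(\tau)$, $\tau\in\mathfrak{S}_n$ (each pile is regarded with its elements decreasing from bottom to top). The shape $\mathrm{sh}(R)=(|r_1|,\dots,|r_m|)$. For a pile configuration $R=(r_1,\dots,r_m)$, $RPW(R)$ is the word obtained by concatenating $r_1,\dots,r_m$, each written in decreasing order; for $S=(s_1,\dots,s_m)$,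 $RPW(S')$ is the word obtained by concatenating $s_1,\dots,s_m$, each written in increasing order. For words $u,v$ of length $n$ and patterns $p,q\in\{31\mathrm{-}2,13\mathrm{-}2,32\mathrm{-}1\}$ (where $31\mathrm{-}2$ means a subsequence $u_a u_{a+1} u_c$, $a+1<c$, order-isomorphic to $312$; similarly $13\mathrm{-}2$ for $132$ and $32\mathrm{-}1$ for $321$), $(u,v)$ has a simultaneous occurrence of $(p,q)$ at the same positions if there are $a<a+1<c$ such that $u_au_{a+1}u_c$ is an occurrence of $p$ and $v_av_{a+1}v_c$ is an occurrence of $q$; avoiding means no such positions exist. *)

(* Defs.v *)
(* The ground set [n] = {1, ..., n} is 'I_n, i.e. cards and positions are
   numbered from 0; only their relative order matters. *)
From mathcomp Require Import all_boot all_fingroup.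
From mathcomp Require Import classical_sets.

Set Implicit Arguments.
Unset Strict Implicit.
Unset Printing Implicit Defensive.

(* A state lists, from left to right, the insertion piles as stacks (top card
   first), each paired with the list of positions its cards came from.  Piles
   are never empty, so the default value of head is never used. *)
Definition state n := seq (seq 'I_n * seq 'I_n).

Fixpoint insert_card n (i c : 'I_n) (st : state n) : state n :=
  match st with
  | [::] => [:: ([:: c], [:: i])]
  | (r, s) :: st' =>
      if c < head c r then (c :: r, i :: s) :: st'
      else (r, s) :: insert_card i c st'
  end.

Definition patience_state n (sigma : 'S_n) : state n :=
  foldl (fun st i => insert_card i (sigma i) st) [::] (enum 'I_n).

Definition insertion_piles n (sigma : 'S_n) : seq {set 'I_n} :=
  [seq [set x in rs.1] | rs <- patience_state sigma].

Definition recording_piles n (sigma : 'S_n) : seq {set 'I_n} :=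
  [seq [set x in rs.2] | rs <- patience_state sigma].

Definition extended_patience n (sigma : 'S_n) :
    seq {set 'I_n} * seq {set 'I_n} :=
  (insertion_piles sigma, recording_piles sigma).

Definition pile_configuration n (R : seq {set 'I_n}) : Prop :=
  exists tau : 'S_n, R = insertion_piles tau.

Definition pile_shape n (R : seq {set 'I_n}) : seq nat :=
  [seq #|r| | r : {set 'I_n} <- R].

Definition increasing_word n (r : {set 'I_n}) : seq nat :=
  sort leq [seq val x | x <- enum r].

Definition decreasing_word n (r : {set 'I_n}) : seq nat :=
  sort geq [seq val x | x <- enum r].

(* RPW(R) *)
Definition rpw n (R : seq {set 'I_n}) : seq nat :=
  flatten [seq decreasing_word r | r <- R].

(* RPW(S') *)
Definition rpw_rev n (S : seq {set 'I_n}) : seq nat :=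
  flatten [seq increasing_word s | s <- S].

Definition order_isomorphic (x y : seq nat) : bool :=
  (size x == size y) &&
  [forall i : 'I_(size x), forall j : 'I_(size x),
     (nth 0 x i < nth 0 x j) == (nth 0 y i < nth 0 y j)].

(* The letters of w at (0-based) positions a, a+1, c, with a+1 < c, form an
   occurrence of the pattern p_1 p_2 - p_3, where p = [:: p_1; p_2; p_3]. *)
Definition occurrence (p w : seq nat) (a c : nat) : bool :=
  [&& a.+1 < c, c < size w &
      order_isomorphic [:: nth 0 w a; nth 0 w a.+1; nth 0 w c] p].

Definition p31_2 : seq nat := [:: 3; 1; 2].
Definition p13_2 : seq nat := [:: 1; 3; 2].
Definition p32_1 : seq nat := [:: 3; 2; 1].

Definition avoids_simultaneously (u v p q : seq nat) : Prop :=
  ~ exists a c : nat, occurrence p u a c /\ occurrence q v a c.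

Definition Sigma n : set (seq {set 'I_n} * seq {set 'I_n}) :=
  fun RS =>
    let u := rpw RS.1 in
    let v := rpw_rev RS.2 in
    [/\ pile_configuration RS.1, pile_configuration RS.2,
        pile_shape RS.1 = pile_shape RS.2
      & [/\ avoids_simultaneously u v p31_2 p13_2,
            avoids_simultaneously u v p31_2 p32_1
          & avoids_simultaneously u v p32_1 p13_2]].
Arguments Sigma : clear implicits.

(* Main.v *)
(* View sigma as the set of its points (i, sigma i).  The pile of a point is the
   length of the longest increasing subsequence that ends at it, so the
   recording piles are the unique decomposition of the positions into nonempty
   layers such that sigma is decreasing on each layer and every point of layer
   j+1 has a point of layer j to its south-west.  This characterization is
   symmetric under inversion, whence S(sigma) = R(sigma^-1).

   Two pile configurations R, S of the same shape determine a permutation sigma: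
   match each s_j, in increasing order, with r_j, in decreasing order.  Suppose
   that a point z of layer j+1 has no point of layer j to its south-west.  As R
   and S are pile configurations, layer j has a point to the left of z and a
   point below z, so z lies, horizontally, between two consecutive points of
   layer j, the left one being above z: the three points form a simultaneous
   occurrence of (31-2, 13-2) or (32-1, 13-2).  Conversely, for layers of a
   permutation such an occurrence contradicts the existence of south-west
   points.  The pair (31-2, 32-1) cannot occur simultaneously, since a descent
   of RPW(R) lies inside a pile, where RPW(S') ascends. *)
Require Import Defs.
From mathcomp Require Import all_boot all_fingroup.

Set Implicit Arguments.
Unset Strict Implicit.
Unset Printing Implicit Defensive.

(** * Layers of a permutation and their uniqueness *)

Definition southwest n (sigma : 'S_n) : rel 'I_n :=
  fun i i' => (i < i') && (sigma i < sigma i').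

Definition decreasing_on n (sigma : 'S_n) (A : {set 'I_n}) :=
  {in A &, forall i i' : 'I_n, i < i' -> sigma i' < sigma i}.

(* Out-of-range indices give the empty layer set0, so [nth set0 S j] needs no
   bound on j. *)
Record layered n (sigma : 'S_n) (S : seq {set 'I_n}) : Prop := Layered {
  layered_nonempty : set0 \notin S;
  layered_cover : forall i, exists j, i \in nth set0 S j;
  layered_decreasing : forall j, decreasing_on sigma (nth set0 S j);
  layered_southwest : forall j i, i \in nth set0 S j.+1 ->
    exists2 i', i' \in nth set0 S j & southwest sigma i' i }.

Lemma southwest_trans n (sigma : 'S_n) : transitive (southwest sigma).
Proof.
by move=> y x z /andP[xy sxy] /andP[yz syz]; rewrite /southwest !(ltn_trans _ yz, ltn_trans _ syz).
Qed.

Lemma perm_neq_val n (sigma : 'S_n) (i i' : 'I_n) :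
  i < i' -> val (sigma i) != val (sigma i').
Proof.
by move=> lt; apply: contraTneq lt => /val_inj /perm_inj ->; rewrite ltnn.
Qed.

Lemma layered_descend n (sigma : 'S_n) S j k i :
  layered sigma S -> j < k -> i \in nth set0 S k ->
  exists2 i', i' \in nth set0 S j & southwest sigma i' i.
Proof.
move=> LS; elim: k i => // k IH i; rewrite ltnS leq_eqVlt.
move=> /orP[/eqP->|jk] /(layered_southwest LS)// [i1 /(IH _ jk)[i2 Hi2 b21] b1].
by exists i2 => //; apply: southwest_trans b21 b1.
Qed.

(** If [k <= j], descending from [i] to layer [k] gives a point of layer [k] south-west of [i'],
    which lies in the same decreasing layer. *)
Lemma layered_mono n (sigma : 'S_n) S j k i i' :
  layered sigma S -> southwest sigma i i' ->
  i \in nth set0 S j -> i' \in nth set0 S k -> j < k.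
Proof.
move=> LS b ij ik; rewrite ltnNge; apply/negP => kj.
have [i0 i0k /andP[lt slt]] : exists2 i0, i0 \in nth set0 S k & southwest sigma i0 i'.
  move: kj; rewrite leq_eqVlt => /orP[/eqP kj|kj]; first by exists i; rewrite ?kj.
  have [i0 i0k b0] := layered_descend LS kj ij.
  by exists i0 => //; apply: southwest_trans b0 b.
by have := layered_decreasing LS i0k ik lt; rewrite ltnNge ltnW.
Qed.

Lemma layered_disjoint n (sigma : 'S_n) S j k i :
  layered sigma S -> i \in nth set0 S j -> i \in nth set0 S k -> j = k.
Proof.
move=> LS; wlog: j k / j <= k.
  by move=> W ij ik; case: (leqP j k) => [/W->//|/ltnW/W->].
rewrite leq_eqVlt => /orP[/eqP//|jk] ij ik.
have [i' ij' /andP[lt slt]] := layered_descend LS jk ik.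
by have := layered_decreasing LS ij' ij lt; rewrite ltnNge ltnW.
Qed.

(** Induction on the position: a south-west neighbour of [i] in layer [j - 1] of [S] has index at
    least [j - 1] in [T], and indices in [T] grow strictly along [southwest]. *)
Lemma layered_index_le n (sigma : 'S_n) S T j k i :
  layered sigma S -> layered sigma T ->
  i \in nth set0 S j -> i \in nth set0 T k -> j <= k.
Proof.
move: S T j k; have [m] := ubnP (val i); elim: m i => // m IH i im S T [//|j] k LS LT.
move=> /(layered_southwest LS)[i' ij' b] ik.
have im' : i' < m by case/andP: b => lt _; apply: leq_trans lt im.
have [k' ik'] := layered_cover LT i'.
by apply: leq_ltn_trans (IH i' im' S T j k' LS LT ij' ik') (layered_mono LT b ik' ik).
Qed.

(** Recovers the number of layers from the function [nth set0 S], so that equality can be proved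
    entrywise. *)
Lemma nth_nonempty n (S : seq {set 'I_n}) j :
  set0 \notin S -> (j < size S) = (nth set0 S j != set0).
Proof.
move=> S0; case: ltnP => [/(mem_nth set0)|/(nth_default set0)->]; last by rewrite eqxx.
by move=> Sj; apply/esym; apply: contraNneq S0 => <-.
Qed.

Lemma layered_unique n (sigma : 'S_n) S T :
  layered sigma S -> layered sigma T -> S = T.
Proof.
have sub S1 T1 j : layered sigma S1 -> layered sigma T1 ->
    nth set0 S1 j \subset nth set0 T1 j.
  move=> LS LT; apply/subsetP => i ij; have [k ik] := layered_cover LT i.
  suff -> : j = k by [].
  by apply/eqP; rewrite eqn_leq (layered_index_le LS LT ij ik) (layered_index_le LT LS ik ij).
move=> LS LT.
have eqn j : nth set0 S j = nth set0 T j by apply/eqP; rewrite eqEsubset !sub.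
apply: (@eq_from_nth _ set0) => [|j _ //].
have szP j : (j < size S) = (j < size T).
  by rewrite !nth_nonempty ?eqn // ?(layered_nonempty LS) ?(layered_nonempty LT).
by apply/eqP; rewrite eqn_leq leqNgt szP ltnn leqNgt -szP ltnn.
Qed.

(** * Layers under inversion *)

Definition image_piles n (sigma : 'S_n) (S : seq {set 'I_n}) : seq {set 'I_n} :=
  [seq sigma @: (A : {set 'I_n}) | A <- S].

Lemma nth_image_piles n (sigma : 'S_n) S j :
  nth set0 (image_piles sigma S) j = sigma @: nth set0 S j.
Proof.
case: (ltnP j (size S)) => jS; first by rewrite (nth_map set0).
by rewrite !nth_default ?size_map // imset0.
Qed.

Lemma mem_image_piles n (sigma : 'S_n) S j i :
  (i \in nth set0 (image_piles sigma S) j) = ((sigma^-1)%g i \in nth set0 S j).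
Proof. by rewrite nth_image_piles -{1}(permKV sigma i) mem_imset //; apply: perm_inj. Qed.

(** Reflecting the points in the diagonal preserves the south-west relation and turns decreasing
    layers into decreasing layers. *)
Lemma layeredV n (sigma : 'S_n) S :
  layered sigma S -> layered sigma^-1 (image_piles sigma S).
Proof.
move=> LS; split=> [|i|j i i'|j i].
- apply: contra (layered_nonempty LS) => /mapP[A AS /esym/eqP].
  by rewrite imset_eq0 => /eqP <-.
- by have [j ij] := layered_cover LS (sigma^-1 i)%g; exists j; rewrite mem_image_piles.
- rewrite !mem_image_piles => ij ij' lt; rewrite ltnNge leq_eqVlt; apply/negP => /orP[/eqP|ltV].
    by apply/eqP; apply: perm_neq_val.
  by have := layered_decreasing LS ij ij' ltV; rewrite !permKV ltnNge ltnW.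
rewrite mem_image_piles => /(layered_southwest LS)[i' ij' /andP[lt slt]].
exists (sigma i'); first by rewrite mem_image_piles permK.
by rewrite permKV in slt; rewrite /southwest permK lt slt.
Qed.

(** * Patience sorting produces the layers *)

(* P is the condition imposed on the first pile by the pile to its left. *)
Fixpoint stacked n (sigma : 'S_n) (P : pred 'I_n) (st : state n) : Prop :=
  match st with
  | [::] => True
  | (r, s) :: st' =>
      [/\ s <> [::], r = map sigma s,
          sorted (fun i i' : 'I_n => (i' < i) && (sigma i < sigma i')) s,
          all P s
        & stacked sigma [pred i | has (fun i' => southwest sigma i' i) s] st']
  end.

Definition positions n (st : state n) : seq 'I_n := flatten (unzip2 st).

Lemma sub_stacked n (sigma : 'S_n) (P Q : pred 'I_n) st :
  subpred P Q -> stacked sigma P st -> stacked sigma Q st.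
Proof.
by case: st => // [[r s] st] PQ [? ? ? /(sub_all PQ) ? ?].
Qed.

Lemma positions_insert n (sigma : 'S_n) i st :
  perm_eq (positions (insert_card i (sigma i) st)) (i :: positions st).
Proof.
elim: st => // [[r s] st] IH /=; case: ifP => _ //.
rewrite /positions /= in IH *.
by rewrite (perm_catl _ IH) perm_catC /= perm_cons perm_catC.
Qed.

(** A pile that the new card passes over has a smaller top card, placed earlier; this top is the
    south-west point required by the next pile. *)
Lemma stacked_insert n (sigma : 'S_n) (P : pred 'I_n) i st :
  stacked sigma P st -> P i -> (forall i', i' \in positions st -> i' < i) ->
  stacked sigma P (insert_card i (sigma i) st).
Proof.
elim: st P => [|[r s] st IH] P /=; first by move=> _ ->.
case=> s0 -> ord Ps stP Pi lt; case: s s0 ord Ps stP lt => // h s _ /= ord Ps stP lt.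
have hi : h < i by apply: lt; rewrite mem_head.
case: ltnP => [ci|ci] /=; split=> //.
- by rewrite hi ci.
- by rewrite Pi.
(* The pile has gained a card, so the condition on its right neighbour only weakens. *)
- by apply: sub_stacked stP => j /= ->; rewrite orbT.
apply: IH => [//||i' i'st].
  by rewrite /= /southwest hi ltn_neqAle ci andbT (perm_neq_val sigma hi).
by apply: lt; rewrite /positions /= inE mem_cat i'st !orbT.
Qed.

Lemma stacked_patience n (sigma : 'S_n) :
  stacked sigma predT (patience_state sigma) /\
  perm_eq (positions (patience_state sigma)) (enum 'I_n).
Proof.
rewrite /patience_state.
have: sorted (fun i i' : 'I_n => i < i') (enum 'I_n).
  by have := iota_ltn_sorted 0 n; rewrite -val_enum_ord sorted_map.
elim/last_ind: (enum 'I_n) => // l i IH.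
rewrite foldl_rcons; set st := foldl _ _ _ in IH *.
rewrite sorted_pairwise; last by move=> ? ? ?; apply: ltn_trans.
rewrite pairwise_rcons => /andP[/allP li]; rewrite -sorted_pairwise; last first.
  by move=> ? ? ?; apply: ltn_trans.
move=> /IH[st_ok st_l]; split.
  by apply: stacked_insert => // i'; rewrite (perm_mem st_l) => /li.
by rewrite (perm_trans (positions_insert _ _ _)) // perm_sym perm_rcons perm_cons perm_sym.
Qed.

Lemma stacked_nth n (sigma : 'S_n) P st j :
  stacked sigma P st -> j < size st ->
  let rs := nth ([::], [::]) st in
  [/\ (rs j).2 <> [::], (rs j).1 = map sigma (rs j).2,
      sorted (fun i i' : 'I_n => (i' < i) && (sigma i < sigma i')) (rs j).2
    & j.+1 < size st -> forall i, i \in (rs j.+1).2 ->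
        exists2 i', i' \in (rs j).2 & southwest sigma i' i].
Proof.
elim: st P j => // [[r s] st] IH P [|j] /= [? ? ? ? stP]; last exact: (IH _ j stP).
move=> _; split=> //; case: st stP {IH} => // [[r' s'] st] /= [_ _ _ /allP s'P _] _ i /s'P.
by move=> /hasP[i' ? ?]; exists i'.
Qed.

Lemma nth_recording_piles n (sigma : 'S_n) j :
  nth set0 (recording_piles sigma) j =
  [set x in (nth ([::], [::]) (patience_state sigma) j).2].
Proof.
case: (ltnP j (size (patience_state sigma))) => lt; first by rewrite (nth_map ([::], [::])).
by rewrite !nth_default ?size_map //; apply/setP => x; rewrite !inE.
Qed.

Lemma layered_recording_piles n (sigma : 'S_n) :
  layered sigma (recording_piles sigma).
Proof.
have [stP stE] := stacked_patience sigma.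
split=> [|i|j i i'|j i]; rewrite ?nth_recording_piles.
- apply/(nthP set0) => -[j]; rewrite size_map => lt; rewrite nth_recording_piles.
  have [s0 _ _ _] := stacked_nth stP lt.
  by case: (_.2) s0 => // x s _ /setP/(_ x); rewrite !inE eqxx.
- have : i \in positions (patience_state sigma) by rewrite (perm_mem stE) mem_enum.
  move=> /flattenP[s /(nthP [::])[j]]; rewrite size_map => lt <- ij.
  by exists j; rewrite nth_recording_piles inE -(nth_map _ [::]).
- case: (ltnP j (size (patience_state sigma))) => lt; last by rewrite nth_default // inE.
  have [_ _ ord _] := stacked_nth stP lt.
  rewrite !inE => ij ij' ii'.
  have tr : transitive (fun i i' : 'I_n => (i' < i) && (sigma i < sigma i')).
    by move=> y x z /andP[a b] /andP[c d]; rewrite (ltn_trans c a) (ltn_trans b d).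
  have /= idx := sorted_ltn_index tr ord.
  (* Stacks list later positions first, so [i < i'] forces [i'] to come before [i]. *)
  case: (ltngtP (index i' (nth ([::], [::]) (patience_state sigma) j).2)
     (index i (nth ([::], [::]) (patience_state sigma) j).2)) => [||/index_inj E].
  + by move/(idx _ _ ij' ij)/andP=> [].
  + by move/(idx _ _ ij ij')/andP=> [lt' _]; rewrite ltnNge ltnW in ii'.
  + by rewrite E // ltnn in ii'.
case: (ltnP j.+1 (size (patience_state sigma))) => lt; last by rewrite nth_default ?inE.
have [_ _ _ below_j] := stacked_nth stP (ltnW lt).
by rewrite inE => /(below_j lt)[i' ij' b]; exists i' => //; rewrite ?nth_recording_piles ?inE.
Qed.

Lemma insertion_pilesE n (sigma : 'S_n) :
  insertion_piles sigma = image_piles sigma (recording_piles sigma).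
Proof.
have [stP _] := stacked_patience sigma.
rewrite /image_piles -map_comp; apply: (@eq_from_nth _ set0); rewrite ?size_map // => j lt.
rewrite !(nth_map ([::], [::])) //=; have [_ -> _ _] := stacked_nth stP lt.
apply/setP => x; rewrite inE; apply/mapP/imsetP => -[y]; rewrite ?inE => ys ->; exists y => //.
by rewrite inE.
Qed.

(** Both sides are layers of the inverse permutation, and layers are unique. *)
Lemma recording_pilesV n (sigma : 'S_n) :
  recording_piles sigma^-1 = insertion_piles sigma.
Proof.
apply: layered_unique (layered_recording_piles _) _.
by rewrite insertion_pilesE; apply/layeredV/layered_recording_piles.
Qed.

Lemma insertion_pilesV n (sigma : 'S_n) :
  insertion_piles sigma^-1 = recording_piles sigma.
Proof. by rewrite -recording_pilesV invgK. Qed.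

(** * Pile words as words over positions *)

Lemma sorted_enum_set n (A : {set 'I_n}) :
  sorted (fun i i' : 'I_n => i < i') (enum A).
Proof.
rewrite {1}/enum_mem sorted_filter //; first by move=> ? ? ?; apply: ltn_trans.
by have := iota_ltn_sorted 0 n; rewrite -val_enum_ord sorted_map -enumT.
Qed.

Lemma sorted_enum_decreasing n (sigma : 'S_n) (A : {set 'I_n}) :
  decreasing_on sigma A -> sorted (fun x y : 'I_n => y < x) (map sigma (enum A)).
Proof.
move=> dec; rewrite sorted_map.
have eA : all (mem A) (enum A) by apply/allP => i; rewrite mem_enum.
by apply: (sub_in_sorted _ eA) (sorted_enum_set A) => i i'; apply: dec.
Qed.

Lemma increasing_wordE n (A : {set 'I_n}) : increasing_word A = map val (enum A).
Proof.
apply: sorted_sort; first exact: leq_trans.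
by rewrite sorted_map; apply: sub_sorted (sorted_enum_set A) => i i' /ltnW.
Qed.

Lemma decreasing_wordE n (sigma : 'S_n) (A : {set 'I_n}) :
  decreasing_on sigma A ->
  decreasing_word (sigma @: A) = [seq val (sigma i) | i <- enum A].
Proof.
move=> dec; rewrite /decreasing_word.
have geq_trans : transitive geq by move=> y x z /= xy yz; apply: leq_trans xy.
apply: (@sorted_eq _ geq) => //.
- by move=> x y; rewrite andbC => /anti_leq.
- by apply: sort_sorted => x y; apply: leq_total.
- rewrite (map_comp val sigma) sorted_map.
  by apply: sub_sorted (sorted_enum_decreasing dec) => x y /ltnW.
rewrite perm_sort (map_comp val sigma); apply/perm_map/uniq_perm.
- exact: enum_uniq.
- by rewrite (map_inj_uniq perm_inj) enum_uniq.
by move=> x; rewrite mem_enum; apply/imsetP/mapP => -[i iA ->]; exists i; rewrite ?mem_enum // -mem_enum.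
Qed.

(** The common index of both words: its letters are those of [RPW(S')], and applying [sigma] to them
    gives [RPW(R)] when [sigma] decreases on every layer and [R] is the image of [S]. *)
Definition layer_word n (S : seq {set 'I_n}) : seq 'I_n :=
  flatten [seq enum A | A : {set 'I_n} <- S].

Lemma rpw_revE n (S : seq {set 'I_n}) : rpw_rev S = map val (layer_word S).
Proof.
rewrite /rpw_rev /layer_word map_flatten -map_comp.
by congr flatten; apply: eq_map => A; apply: increasing_wordE.
Qed.

Lemma rpwE n (sigma : 'S_n) S :
  (forall j, decreasing_on sigma (nth set0 S j)) ->
  rpw (image_piles sigma S) = [seq val (sigma i) | i <- layer_word S].
Proof.
move=> dec; rewrite /rpw /layer_word map_flatten /image_piles -!map_comp.
congr flatten; apply/eq_in_map => A /(nthP set0)[j _ <-] /=.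
exact: decreasing_wordE.
Qed.

Lemma layer_word_nthP n (S : seq {set 'I_n}) i :
  reflect (exists j, i \in nth set0 S j) (i \in layer_word S).
Proof.
apply: (iffP flattenP) => [[_ /mapP[A /(nthP set0)[j _ <-] ->]]|[j ij]].
  by rewrite mem_enum => ij; exists j.
exists (enum (nth set0 S j)); last by rewrite mem_enum.
by apply/map_f/mem_nth; case: ltnP ij => // /(nth_default set0)->; rewrite inE.
Qed.

(** * The order of letters in the layer word *)

Definition pile_of n (S : seq {set 'I_n}) (i : 'I_n) : nat :=
  find (fun A : {set 'I_n} => i \in A) S.

(* The order in which positions appear in the word of layers. *)
Definition precedes n (S : seq {set 'I_n}) : rel 'I_n :=
  fun i i' => (pile_of S i < pile_of S i') ||
              ((pile_of S i == pile_of S i') && (i < i')).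

Lemma precedes_trans n (S : seq {set 'I_n}) : transitive (precedes S).
Proof.
move=> y x z; rewrite /precedes => /orP[xy|/andP[/eqP-> xy]] /orP[yz|/andP[/eqP<- yz]].
- by rewrite (ltn_trans xy yz).
- by rewrite xy.
- by rewrite yz.
- by rewrite eqxx (ltn_trans xy yz) orbT.
Qed.

Lemma precedes_irr n (S : seq {set 'I_n}) : irreflexive (precedes S).
Proof. by move=> x; rewrite /precedes !ltnn andbF. Qed.

Lemma pairwise_flatten (T : Type) (r : rel T) (ss : seq (seq T)) :
  pairwise r (flatten ss) = all (pairwise r) ss && pairwise (allrel r) ss.
Proof.
elim: ss => //= s ss IH; rewrite pairwise_cat IH.
have -> : allrel r s (flatten ss) = all (allrel r s) ss.
  by elim: ss {IH} => [|s' ss IH] /=; rewrite ?allrel0r // allrel_catr IH.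
by case: (pairwise r s) => //=; case: (all (allrel r s) ss); rewrite ?andbF.
Qed.

Lemma mem_pile_of n (sigma : 'S_n) S i :
  layered sigma S -> i \in nth set0 S (pile_of S i).
Proof.
move=> LS; have [j ij] := layered_cover LS i.
apply: (@nth_find _ set0 (fun A : {set 'I_n} => i \in A)); apply/hasP; exists (nth set0 S j) => //.
by apply: mem_nth; case: ltnP ij => // /(nth_default set0)->; rewrite inE.
Qed.

Lemma pile_ofE n (sigma : 'S_n) S i j :
  layered sigma S -> i \in nth set0 S j -> pile_of S i = j.
Proof. by move=> LS ij; apply: layered_disjoint LS (mem_pile_of i LS) ij. Qed.

Lemma layer_word_sorted n (sigma : 'S_n) S :
  layered sigma S -> sorted (precedes S) (layer_word S).
Proof.
move=> LS; apply: pairwise_sorted; rewrite pairwise_flatten; apply/andP; split.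
  apply/allP => _ /mapP[A /(nthP set0)[j _ <-] ->].
  rewrite -sorted_pairwise; last exact: precedes_trans.
  have eA : all (mem (nth set0 S j)) (enum (nth set0 S j)) by apply/allP => i; rewrite mem_enum.
  apply: (sub_in_sorted _ eA) (sorted_enum_set _) => i i' ij ij' ii'.
  by rewrite /precedes !(pile_ofE LS ij) (pile_ofE LS ij') ii' eqxx orbT.
rewrite pairwise_map; apply/(pairwiseP set0) => j k _ _ jk.
apply/allrelP => i i'; rewrite !mem_enum => ij ik.
by rewrite /precedes (pile_ofE LS ij) (pile_ofE LS ik) jk.
Qed.

Lemma layer_word_uniq n (sigma : 'S_n) S : layered sigma S -> uniq (layer_word S).
Proof.
move=> LS; apply: sorted_uniq (layer_word_sorted LS).
- exact: precedes_trans.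
- exact: precedes_irr.
Qed.

Lemma mem_layer_word n (sigma : 'S_n) S i : layered sigma S -> i \in layer_word S.
Proof. by move=> LS; apply/layer_word_nthP; apply: layered_cover LS i. Qed.

Lemma precedes_index n (sigma : 'S_n) S i i' :
  layered sigma S -> precedes S i i' = (index i (layer_word S) < index i' (layer_word S)).
Proof.
move=> LS; have tr := @precedes_trans n S.
have lt := sorted_ltn_index tr (layer_word_sorted LS).
have mem x : x \in layer_word S := mem_layer_word x LS.
apply/idP/idP => [b|]; last exact: lt.
rewrite ltnNge leq_eqVlt; apply/negP => /orP[/eqP/esym/index_inj E|/lt - /(_ (mem _) (mem _)) b'].
  by rewrite E // precedes_irr in b.
by have := tr _ _ _ b b'; rewrite precedes_irr.
Qed.

(** * Layers of a permutation avoid the patterns *)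

Lemma order_isomorphic3 (x y z p q r : nat) :
  order_isomorphic [:: x; y; z] [:: p; q; r] =
  [&& (x < y) == (p < q), (y < x) == (q < p),
      (x < z) == (p < r), (z < x) == (r < p),
      (y < z) == (q < r) & (z < y) == (r < q)].
Proof.
rewrite /order_isomorphic /=; apply/forallP/idP => [H|].
  have h i j (i3 : i < 3) (j3 : j < 3) := forallP (H (Ordinal i3)) (Ordinal j3).
  by rewrite (h 0 1) // (h 1 0) // (h 0 2) // (h 2 0) // (h 1 2) // (h 2 1).
move=> /and5P[h1 h2 h3 h4 /andP[h5 h6]] [[|[|[|//]]] ?]; apply/forallP => -[[|[|[|//]]] ?] //=.
- by rewrite !ltnn.
- by rewrite !ltnn.
- by rewrite !ltnn.
Qed.

Lemma pile_of_le n (S : seq {set 'I_n}) i i' : precedes S i i' -> pile_of S i <= pile_of S i'.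
Proof. by case/orP=> [/ltnW//|/andP[/eqP->]]. Qed.

(** Otherwise [z] lies in a later layer than [x], and descending from [z] gives [x'] in the layer of
    [x], below [x] and hence to its right. As [x' < z < y], the letter [x'] would stand strictly
    between the consecutive letters [x] and [y]. *)
Lemma layered_consecutive_lt n (sigma : 'S_n) S (x y z : 'I_n) :
  layered sigma S ->
  let pos i := index i (layer_word S) in
  pos y = (pos x).+1 -> pos y < pos z ->
  x < z -> z < y -> sigma x < sigma z.
Proof.
move=> LS pos xy yz xz zy; rewrite ltnNge; apply/negP => szx.
have posE i i' : precedes S i i' = (pos i < pos i') by apply: precedes_index LS.
have {}yz : precedes S y z by rewrite posE.
have {}xy' : precedes S x y by rewrite posE xy.
have mem i := mem_pile_of i LS.
(* In the first case [y] and [z] share a layer, so [y] preceding [z] would mean [y < z]. *)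
have [zx|] := leqP (pile_of S z) (pile_of S x).
  move: yz; rewrite /precedes ltnNge (leq_trans zx (pile_of_le xy')) /= => /andP[_].
  by rewrite ltnNge ltnW.
move=> /(layered_descend LS)/(_ (mem z))[x' x'x /andP[x'z sx'z]].
have xx' : x < x'.
  rewrite ltnNge leq_eqVlt; apply/negP => /orP[/eqP/val_inj E|lt].
    by rewrite E ltnNge szx in sx'z.
  by have := layered_decreasing LS x'x (mem x) lt; rewrite ltnNge (leq_trans (ltnW sx'z)).
have px' := pile_ofE LS x'x.
have bxx' : precedes S x x' by rewrite /precedes px' eqxx xx' orbT.
have bx'y : precedes S x' y.
  move: (pile_of_le xy'); rewrite /precedes px' leq_eqVlt => /orP[->|->//].
  by rewrite (ltn_trans x'z zy) orbT.
by move: bxx' bx'y; rewrite !posE xy => h1; rewrite ltnS leqNgt h1.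
Qed.

(** The pattern 13-2 on positions gives [x < z < y], hence [sigma x < sigma z], whereas 31-2 and
    32-1 both have their last letter below their first. *)
Lemma layered_avoids n (sigma : 'S_n) S (p : seq nat) :
  layered sigma S -> p \in [:: p31_2; p32_1] ->
  avoids_simultaneously [seq val (sigma i) | i <- layer_word S]
    (map val (layer_word S)) p p13_2.
Proof.
move=> LS p_in [a [c []]]; rewrite /occurrence !size_map.
move=> /and3P[ac cw u_iso] /and3P[_ _].
have aw : a.+1 < size (layer_word S) by apply: ltn_trans cw.
have x0 : 'I_n by case: (layer_word S) cw.
rewrite !(nth_map x0) ?(ltnW aw) // in u_iso *.
set x := nth x0 _ a in u_iso *; set y := nth x0 _ a.+1 in u_iso *.
set z := nth x0 _ c in u_iso *.
rewrite order_isomorphic3 => /and5P[_ _ /eqP xz _ /andP[_ /eqP zy]].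
have := @layered_consecutive_lt n sigma S x y z LS.
rewrite /= !index_uniq ?(layer_word_uniq LS) ?(ltnW aw) // => /(_ erefl ac xz zy) sxz.
move: p_in u_iso; rewrite !inE => /orP[]/eqP->; rewrite order_isomorphic3 sxz /=.
- by rewrite /= !andbF.
- by rewrite /= !andbF.
Qed.

Lemma layered_avoids_descent n (sigma : 'S_n) S :
  layered sigma S ->
  avoids_simultaneously [seq val (sigma i) | i <- layer_word S]
    (map val (layer_word S)) p31_2 p32_1.
Proof.
move=> LS [a [c []]]; rewrite /occurrence !size_map.
move=> /and3P[ac cw u_iso] /and3P[_ _].
have aw : a.+1 < size (layer_word S) by apply: ltn_trans cw.
have x0 : 'I_n by case: (layer_word S) cw.
rewrite !(nth_map x0) ?(ltnW aw) // in u_iso *.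
move: u_iso; rewrite !order_isomorphic3.
set x := nth x0 _ a; set y := nth x0 _ a.+1; set z := nth x0 _ c.
move=> /and3P[_ /eqP syx _] /and3P[_ /eqP yx _].
have : precedes S x y.
  by rewrite (precedes_index _ _ LS) !index_uniq ?(layer_word_uniq LS) ?(ltnW aw).
rewrite /precedes (leq_gtF (ltnW yx)) andbF orbF => xy.
(* Since [y < x], the letter [y] is in a later layer; the point [x'] below it would be south-west of
   [x] within the layer of [x]. *)
have [x' x'x /andP[x'y sx'y]] := layered_descend LS xy (mem_pile_of y LS).
have := layered_decreasing LS x'x (mem_pile_of x LS) (ltn_trans x'y yx).
by rewrite ltnNge (leq_trans (ltnW sx'y) (ltnW syx)).
Qed.

(** * From avoidance to layers *)

Lemma consecutive_around n (tau : 'S_n) S j (i i' i'' : 'I_n) :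
  layered tau S -> i' \in nth set0 S j -> i'' \in nth set0 S j ->
  i \notin nth set0 S j -> i' < i -> i < i'' ->
  let pos i := index i (layer_word S) in
  exists x y, [/\ x \in nth set0 S j, y \in nth set0 S j, x < i < y & pos y = (pos x).+1].
Proof.
move=> LS i'j i''j ij i'i ii'' pos.
pose P x := (x \in nth set0 S j) && (x < i).
pose Q y := (y \in nth set0 S j) && (i < y).
have Pi' : P i' by rewrite /P i'j.
have Qi'' : Q i'' by rewrite /Q i''j.
(* [x] and [y] are the members of layer [j] nearest to [i] on either side. *)
have [x /andP[xj xi] xmax] := arg_maxnP val Pi'.
have [y /andP[yj iy] ymin] := arg_minnP val Qi''.
exists x, y; split; rewrite ?xi //.
have posE k k' : precedes S k k' = (pos k < pos k') by apply: precedes_index LS.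
have xy : pos x < pos y.
  by rewrite -posE /precedes (pile_ofE LS xj) (pile_ofE LS yj) eqxx (ltn_trans xi iy) orbT.
apply/eqP; rewrite eqn_leq xy andbT leqNgt; apply/negP => lt.
(* A letter [t] between [x] and [y] in the word lies in layer [j] and contradicts the choice of [x]
   or of [y]. *)
pose t := nth i (layer_word S) (pos x).+1.
have pt : pos t = (pos x).+1.
  rewrite /pos index_uniq ?(layer_word_uniq LS) //.
  by apply: leq_trans lt _; apply: ltnW; rewrite index_mem (mem_layer_word y LS).
have xt : precedes S x t by rewrite posE pt.
have ty : precedes S t y by rewrite posE pt.
have ptj : pile_of S t = j.
  have := pile_of_le xt; have := pile_of_le ty.
  by rewrite (pile_ofE LS xj) (pile_ofE LS yj) => h1 h2; apply/eqP; rewrite eqn_leq h1.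
have tj : t \in nth set0 S j by rewrite -ptj (mem_pile_of t LS).
move: xt ty; rewrite /precedes ptj (pile_ofE LS xj) (pile_ofE LS yj) ltnn eqxx /= => xt ty.
case: (ltngtP t i) => [ti|it|/val_inj ti].
- by have := xmax t; rewrite /P tj ti => /(_ isT); rewrite /= leqNgt xt.
- by have := ymin t; rewrite /Q tj it => /(_ isT); rewrite /= leqNgt ty.
- by rewrite -ti tj in ij.
Qed.

(* tau and rho only witness that S and the image piles are pile configurations. *)
Lemma avoids_layered n (sigma tau rho : 'S_n) S :
  layered tau S -> layered rho (image_piles sigma S) ->
  (forall j, decreasing_on sigma (nth set0 S j)) ->
  (forall p, p \in [:: p31_2; p32_1] ->
    avoids_simultaneously [seq val (sigma i) | i <- layer_word S]
      (map val (layer_word S)) p p13_2) ->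
  layered sigma S.
Proof.
move=> LS LR dec avoid; split=> //; first exact: layered_nonempty LS.
  exact: layered_cover LS.
move=> j i ij.
(* [S] supplies a point of layer [j] to the left of [i]; the image piles supply one below it. *)
have [i' i'j /andP[i'i _]] := layered_southwest LS ij.
have [v vj /andP[vi _]] : exists2 v, v \in nth set0 (image_piles sigma S) j & southwest rho v (sigma i).
  by apply: (layered_southwest LR); rewrite mem_image_piles permK.
move: vj vi; rewrite nth_image_piles => /imsetP[i'' i''j ->] si''.
have [|noSW] := boolP [exists x in nth set0 S j, southwest sigma x i].
  by move=> /existsP[x /andP[xj b]]; exists x.
have {noSW} SW x : x \in nth set0 S j -> x < i -> sigma i < sigma x.
  move=> xj xi; move/existsPn/(_ x): noSW; rewrite xj /southwest xi /= -leqNgt leq_eqVlt.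
  by rewrite eq_sym (negPf (perm_neq_val sigma xi)).
have nij : i \notin nth set0 S j.
  by apply/negP => /(layered_disjoint LS ij)/eqP; rewrite -[X in _ == X]addn0 -addn1 eqn_add2l.
(* The point [i''] is below [i], so by [SW] it is not to the left. *)
have ii'' : i < i''.
  rewrite ltnNge leq_eqVlt; apply/negP => /orP[/eqP/val_inj E|/(SW _ i''j)].
    by rewrite -E i''j in nij.
  by rewrite ltnNge ltnW.
have [x [y [xj yj /andP[xi iy] xy]]] := consecutive_around LS i'j i''j nij i'i ii''.
have sxi := SW x xj xi; have sxy := dec j x y xj yj (ltn_trans xi iy).
pose pos i := index i (layer_word S).
have mem k : pos k < size (layer_word S) by rewrite index_mem (mem_layer_word k LS).
have yi : pos y < pos i.
  by rewrite -(precedes_index _ _ LS) /precedes (pile_ofE LS yj) (pile_ofE LS ij) leqnn.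
have nthw k : nth i (layer_word S) (pos k) = k by rewrite nth_index // (mem_layer_word k LS).
have v_occ : occurrence p13_2 (map val (layer_word S)) (pos x) (pos i).
  rewrite /occurrence -xy yi size_map mem !(nth_map i) ?mem // !nthw order_isomorphic3.
  by rewrite xi iy (ltn_trans xi iy) (leq_gtF (ltnW xi)) (leq_gtF (ltnW iy)) (leq_gtF (ltnW (ltn_trans xi iy))).
have u_occ p : order_isomorphic [:: val (sigma x); val (sigma y); val (sigma i)] p ->
    occurrence p [seq val (sigma k) | k <- layer_word S] (pos x) (pos i).
  by rewrite /occurrence -xy yi size_map mem !(nth_map i) ?mem // !nthw.
(* Both values are below [sigma x]; their order decides between 31-2 and 32-1. *)
case: (ltngtP (sigma y) (sigma i)) => [lt|lt|/val_inj/perm_inj E].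
- case: (avoid p31_2); rewrite ?inE ?eqxx //; exists (pos x), (pos i); split=> //.
  by apply: u_occ; rewrite order_isomorphic3 lt sxi sxy (leq_gtF (ltnW lt)) (leq_gtF (ltnW sxi)) (leq_gtF (ltnW sxy)).
- case: (avoid p32_1); rewrite ?inE ?eqxx ?orbT //; exists (pos x), (pos i); split=> //.
  by apply: u_occ; rewrite order_isomorphic3 lt sxi sxy (leq_gtF (ltnW lt)) (leq_gtF (ltnW sxi)) (leq_gtF (ltnW sxy)).
- by rewrite E ltnn in iy.
Qed.

(** * Permutations with prescribed piles *)

(** Both maps send the increasing list of [A] to the decreasing list of the same image. *)
Lemma decreasing_image_inj n (sigma tau : 'S_n) (A : {set 'I_n}) :
  decreasing_on sigma A -> decreasing_on tau A -> sigma @: A = tau @: A ->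
  {in A, sigma =1 tau}.
Proof.
move=> ds dt E.
have img (f : 'S_n) : map f (enum A) =i f @: A.
  by move=> x; apply/mapP/imsetP => -[i iA ->]; exists i; rewrite ?mem_enum // -mem_enum.
suff /eq_in_map eqm : map sigma (enum A) = map tau (enum A).
  by move=> i iA; apply: eqm; rewrite mem_enum.
apply: (@irr_sorted_eq _ (fun x y : 'I_n => y < x)).
- by move=> y x z xy yz; apply: ltn_trans yz xy.
- by move=> x; apply: ltnn.
- exact: sorted_enum_decreasing.
- exact: sorted_enum_decreasing.
- by move=> x; rewrite !img E.
Qed.

Lemma perm_of_piles n (tau rho : 'S_n) R S :
  layered tau S -> layered rho R -> pile_shape R = pile_shape S ->
  exists sigma : 'S_n, R = image_piles sigma S /\
    forall j, decreasing_on sigma (nth set0 S j).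
Proof.
move=> LS LR shE.
pose w := layer_word S; pose U := [seq rev (enum A) | A : {set 'I_n} <- R].
have shU : shape U = shape [seq enum A | A : {set 'I_n} <- S].
  rewrite /shape -!map_comp.
  transitivity (pile_shape R); last rewrite shE; apply: eq_map => A /=.
    by rewrite size_rev cardE.
  by rewrite cardE.
have szE : size (flatten U) = size w by rewrite /w /layer_word !size_flatten shU.
have memw i : index i w < size w by rewrite index_mem (mem_layer_word i LS).
have uniqU : uniq (flatten U).
  have := layer_word_uniq LR; apply: etrans; apply: perm_uniq.
  rewrite /layer_word /U; elim: (R) => //= A R' IH.
  by rewrite (perm_catl _ IH) perm_cat2r perm_rev.
(* Matches the two words letter by letter; they have equal length, so the default [i] is never
   reached. *)
pose f i := nth i (flatten U) (index i w).
have f_inj : injective f.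
  move=> i i' /eqP; rewrite /f (set_nth_default i') ?szE // nth_uniq ?szE //.
  by move=> /eqP/(index_inj i); apply; apply: mem_layer_word LS.
pose sigma := perm f_inj.
have mapE : map sigma w = flatten U.
  case E: w => [|i0 w0]; first by move: szE; rewrite E => /size0nil.
  rewrite -E; apply: (@eq_from_nth _ i0); rewrite size_map // => k kw.
  rewrite (nth_map i0) // permE /f index_uniq ?(layer_word_uniq LS) //.
  by apply: set_nth_default; rewrite szE.
(* Equal shapes cut the two words into the same blocks, giving the matching pile by pile. *)
have UE : U = [seq map sigma (enum A) | A : {set 'I_n} <- S].
  apply: eq_from_flatten_shape; first by rewrite -mapE map_flatten -map_comp.
  by rewrite shU /shape -!map_comp; apply: eq_map => A /=; rewrite size_map.
have szRS : size R = size S by rewrite -(size_map (fun A : {set 'I_n} => #|A|)) -/(pile_shape R) shE size_map.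
have nthE j : j < size S -> rev (enum (nth set0 R j)) = map sigma (enum (nth set0 S j)).
  move=> jS; have := congr1 (fun s => nth [::] s j) UE.
  by rewrite !(nth_map set0) // szRS.
exists sigma; split.
  apply: (@eq_from_nth _ set0); rewrite ?size_map // szRS => j jS.
  rewrite nth_image_piles; apply/setP => x.
  rewrite -mem_enum -mem_rev nthE //.
  by apply/mapP/imsetP => -[i iA ->]; exists i; rewrite ?mem_enum // -mem_enum.
move=> j i i' ij i'j ii'.
have jS : j < size S by case: ltnP ij => // /(nth_default set0)->; rewrite inE.
have := sorted_enum_set (nth set0 R j); rewrite -rev_sorted nthE // sorted_map => srt.
have tr : transitive (relpre sigma (fun x y : 'I_n => y < x)).
  by move=> y x z xy yz; apply: ltn_trans yz xy.
have tr' : transitive (fun i i' : 'I_n => i < i') by move=> y x z; apply: ltn_trans.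
apply: (sorted_ltn_index tr srt); rewrite ?mem_enum //.
rewrite ltnNge leq_eqVlt; apply/negP => /orP[/eqP/index_inj E|].
  by rewrite E ?mem_enum ?ltnn in ii'.
move=> /(sorted_ltn_index tr' (sorted_enum_set _)); rewrite !mem_enum => /(_ i'j ij).
by rewrite ltnNge ltnW.
Qed.

(* The bijection *)
From mathcomp Require Import classical_sets functions.

Theorem mainTheorem4 (n : nat) :
  set_bij (@setT 'S_n) (Sigma n) (@extended_patience n).
Proof.
have rec_eq (sigma : 'S_n) S : layered sigma S -> recording_piles sigma = S.
  exact: layered_unique (layered_recording_piles sigma).
split.
- move=> sigma _; have LS := layered_recording_piles sigma.
  have dec := layered_decreasing LS.
  rewrite /Sigma /extended_patience /= insertion_pilesE rpwE // rpw_revE.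
  split.
  + by exists sigma; rewrite insertion_pilesE.
  + by exists (sigma^-1)%g; rewrite insertion_pilesV.
  + rewrite /pile_shape /image_piles -map_comp.
    by apply: eq_map => A /=; rewrite card_imset //; apply: perm_inj.
  split; try by apply: layered_avoids => //; rewrite !inE eqxx ?orbT.
  exact: layered_avoids_descent.
(* Injectivity: on each common layer, [sigma] and [tau] are decreasing with the same image. *)
- move=> sigma tau _ _ [+ S_eq]; rewrite !insertion_pilesE -S_eq => R_eq.
  have LS := layered_recording_piles sigma.
  have LT := layered_recording_piles tau; rewrite -S_eq in LT.
  apply/permP => i; have [j ij] := layered_cover LS i.
  have [ds dt] := (layered_decreasing LS (j := j), layered_decreasing LT (j := j)).
  apply: (decreasing_image_inj ds dt) => //.
  by rewrite -!nth_image_piles R_eq.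
move=> [R S] [/= [rho RE] [tau SE] shE [av1 _ av2]].
(* Insertion piles of a permutation are recording piles of its inverse, so every pile configuration
   is layered. *)
have LS : layered tau^-1 S.
  by rewrite SE -recording_pilesV; apply: layered_recording_piles.
have LR : layered rho^-1 R.
  by rewrite RE -recording_pilesV; apply: layered_recording_piles.
have [sigma [RS dec]] := perm_of_piles LS LR shE.
(* Avoidance makes [S] the layers of [sigma]; by uniqueness they are its recording piles. *)
have Lsigma : layered sigma S.
  rewrite RS in LR; apply: (avoids_layered LS LR dec) => p.
  by rewrite -rpwE // -rpw_revE -RS !inE => /orP[]/eqP->.
by exists sigma => //; rewrite /extended_patience insertion_pilesE (rec_eq _ _ Lsigma) -RS.
Qed.
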